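(* Let $\Omega$ be a semigroup and let $(G,\{\prec_\alpha,\succ_\alpha,\curlyvee_{\alpha,\beta}\}_{\alpha,\beta\in\Omega},p)$ be a Hom-NS-family algebra. Then $(G\otimes\mathbb{K}\Omega,\prec,\succ,\curlyvee,\bar p)$ is a Hom-NS-algebra, where for all $a,b\in G$ and $\alpha,\beta\in\Omega$ $$(a\otimes\alpha)\prec(b\otimes\beta)=(a\prec_\beta b)\otimes\alpha\beta,\qquad (a\otimes\alpha)\succ(b\otimes\beta)=(a\succ_\alpha b)\otimes\alpha\beta,$$ $$(a\otimes\alpha)\curlyvee(b\otimes\beta)=(a\curlyvee_{\alpha,\beta}b)\otimes\alpha\beta,\qquad \bar p(a\otimes\alpha)=p(a)\otimes\alpha.$$ Moreover, if $(G',\{\prec'_\alpha,\succ'_\alpha,\curlyvee'_{\alpha,\beta}\}_{\alpha,\beta\in\Omega},p')$ is another Hom-NS-family algebra and $f:G\to G'$ is a morphism of Hom-NS-family algebras, then the map $\bar f:G\otimes\mathbb{K}\Omega\to G'\otimes\mathbb{K}\Omega$, $a\otimes\alpha\mapsto f(a)\otimes\alpha$, is a morphism between the induced Hom-NS-algebras.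
   Context: Work over a field $\mathbb{K}$ of characteristic $0$; $\mathbb{K}\Omega$ is the semigroup algebra. A Hom-NS-algebra $(G,\prec,\succ,\curlyvee,p)$ is a vector space $G$ with three bilinear operations $\prec,\succ,\curlyvee$ and a linear map $p:G\to G$ that preserves each of the three operations (e.g. $p(x\prec y)=p(x)\prec p(y)$) such that, writing $x\ast y=x\prec y+x\succ y+x\curlyvee y$: $(x\prec y)\prec p(z)=p(x)\prec(y\ast z)$; $(x\succ y)\prec p(z)=p(x)\succ(y\prec z)$; $(x\ast y)\succ p(z)=p(x)\succ(y\succ z)$; $(x\ast y)\curlyvee p(z)+(x\curlyvee y)\prec p(z)=p(x)\succ(y\curlyvee z)+p(x)\curlyvee(y\ast z)$. A morphism of Hom-NS-algebras is a linear map preserving the three operations and commuting with the structure maps. A Hom-NS-family algebra $(G,\{\prec_\alpha,\succ_\alpha,\curlyvee_{\alpha,\beta}\}_{\alpha,\beta\in\Omega},p)$ is a vector space $G$ with bilinear operations $\prec_\alpha,\succ_\alpha,\curlyvee_{\alpha,\beta}:G\times G\to G$ and a linear map $p:G\to G$ preserving each operation such that for all $x,y,z\in G$, $\alpha,\beta,\gamma\in\Omega$: $p(x)\prec_{\alpha\beta}(y\prec_\beta z+y\succ_\alpha z+y\curlyvee_{\alpha,\beta}z)=(x\prec_\alpha y)\prec_\beta p(z)$; $(x\succ_\alpha y)\prec_\beta p(z)=p(x)\succ_\alpha(y\prec_\beta z)$; $(x\prec_\beta y+x\succ_\alpha y+x\curlyvee_{\alpha,\beta}y)\succ_{\alpha\beta}p(z)=p(x)\succ_\alpha(y\succ_\beta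 z)$; $p(x)\succ_\alpha(y\curlyvee_{\beta,\gamma}z)+p(x)\curlyvee_{\alpha,\beta\gamma}(y\prec_\gamma z+y\succ_\beta z+y\curlyvee_{\beta,\gamma}z)=(x\curlyvee_{\alpha,\beta}y)\prec_\gamma p(z)+(x\prec_\beta y+x\succ_\alpha y+x\curlyvee_{\alpha,\beta}y)\curlyvee_{\alpha\beta,\gamma}p(z)$. A morphism of Hom-NS-family algebras is a linear map $f:G\to G'$ with $f(x\prec_\alpha y)=f(x)\prec'_\alpha f(y)$, $f(x\succ_\alpha y)=f(x)\succ'_\alpha f(y)$, $f(x\curlyvee_{\alpha,\beta}y)=f(x)\curlyvee'_{\alpha,\beta}f(y)$ for all $x,y,\alpha,\beta$, and $f\circ p=p'\circ f$. *)

(* Defs.v *)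
From HB Require Import structures.
From mathcomp Require Import all_boot all_order all_algebra.
From mathcomp Require Import finmap.
From mathcomp Require Import boolp.
From mathcomp Require Import monalg.

Set Implicit Arguments.
Unset Strict Implicit.
Unset Printing Implicit Defensive.

Import GRing.Theory.
Local Open Scope ring_scope.
Local Open Scope quotient_scope.

Definition is_bilinear (K : pzRingType) (U V W : lmodType K)
    (f : U -> V -> W) : Prop :=
  (forall u, linear (f u)) /\ (forall v, linear (fun u => f u v)).

(* [{malg R[X]}] is the space of finitely supported functions X -> R, i.e. the
   free R-module on X, and [<< x >>] is the basis vector at x. *)

(* The tensor product U (x) V is the quotient of the free module on U * V by
   the submodule spanned by the bilinearity relations. *)
Section TensorRelations.
Context (K : fieldType) (U V : lmodType K).

Inductive tensor_rel : {malg K[(U * V)%type]} -> Prop :=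
| tensor_rel_l c u u' v :
    tensor_rel (<< (c *: u + u', v) >> - c *: << (u, v) >> - << (u', v) >>)
| tensor_rel_r c u v v' :
    tensor_rel (<< (u, c *: v + v') >> - c *: << (u, v) >> - << (u, v') >>)
| tensor_rel_0 : tensor_rel 0
| tensor_rel_lin c x y :
    tensor_rel x -> tensor_rel y -> tensor_rel (c *: x + y).

Definition tensor_ideal : {pred {malg K[(U * V)%type]}} := fun x => `[< tensor_rel x >].

Fact tensor_ideal_submod : submod_closed tensor_ideal.
Proof.
split=> [|c x y /asboolP hx /asboolP hy]; apply/asboolP.
  exact: tensor_rel_0.
exact: tensor_rel_lin.
Qed.

HB.instance Definition _ :=
  GRing.isSubmodClosed.Build K {malg K[(U * V)%type]} tensor_ideal tensor_ideal_submod.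

Definition tensor : Type := Quotient.quot tensor_ideal.
HB.instance Definition _ := GRing.Zmodule.on tensor.

Definition tensor_pi (x : {malg K[(U * V)%type]}) : tensor := \pi_(Quotient.quot tensor_ideal) x.
Definition tensor_repr (t : tensor) : {malg K[(U * V)%type]} :=
  repr (t : Quotient.quot tensor_ideal).

Lemma tensor_reprK t : tensor_pi (tensor_repr t) = t.
Proof. exact: reprK. Qed.

Lemma tensor_piP x y : tensor_pi x = tensor_pi y <-> tensor_rel (x - y).
Proof.
split=> [/eqP|/asboolP h]; last by apply/eqP; rewrite -Quotient.idealrBE.
by rewrite -Quotient.idealrBE => /asboolP.
Qed.

Lemma tensor_piD x y : tensor_pi (x + y) = tensor_pi x + tensor_pi y.
Proof. exact: Quotient.pi_add. Qed.

Definition tensor_scale (c : K) (t : tensor) : tensor :=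
  tensor_pi (c *: tensor_repr t).

Lemma tensor_piZ c x : tensor_scale c (tensor_pi x) = tensor_pi (c *: x).
Proof.
apply/tensor_piP; rewrite -scalerBr -[_ *: _]addr0.
by apply: tensor_rel_lin (tensor_rel_0); apply/tensor_piP; rewrite tensor_reprK.
Qed.

Fact tensor_scaleA c d t :
  tensor_scale c (tensor_scale d t) = tensor_scale (c * d) t.
Proof. by rewrite -[t]tensor_reprK !tensor_piZ scalerA. Qed.
Fact tensor_scale1 : left_id 1 tensor_scale.
Proof. by move=> t; rewrite -[t]tensor_reprK !tensor_piZ scale1r. Qed.
Fact tensor_scaleDr : right_distributive tensor_scale +%R.
Proof.
move=> c t t'; rewrite -[t]tensor_reprK -[t']tensor_reprK -tensor_piD.
by rewrite !tensor_piZ -tensor_piD scalerDr.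
Qed.
Fact tensor_scaleDl t : {morph tensor_scale^~ t : c d / c + d}.
Proof.
by move=> c d; rewrite -[t]tensor_reprK !tensor_piZ -tensor_piD scalerDl.
Qed.
HB.instance Definition _ := GRing.Zmodule_isLmodule.Build K tensor
  tensor_scaleA tensor_scale1 tensor_scaleDr tensor_scaleDl.

Fact tensor_pi_is_linear : linear tensor_pi.
Proof. by move=> c x y; rewrite tensor_piD -tensor_piZ. Qed.
HB.instance Definition _ :=
  GRing.isLinear.Build K {malg K[(U * V)%type]} tensor *:%R tensor_pi
    tensor_pi_is_linear.

End TensorRelations.

(* Locked: unfolding into the quotient makes failing conversion checks blow up. *)
HB.lock Definition tens (K : fieldType) (U V : lmodType K) (u : U) (v : V) :
  tensor U V := tensor_pi << (u, v) >>.
Arguments tens {K U V} u v.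

Notation "u ⊗ v" := (tens u v) (at level 40, left associativity) : ring_scope.

(* The universal property of the tensor product. *)
Section TensorUniversal.
Context (K : fieldType) (U V : lmodType K).

Lemma tens_bilinear : is_bilinear (@tens K U V).
Proof.
split=> [u c v v'|v c u u']; rewrite tens.unlock -linearP; apply/tensor_piP.
  by rewrite opprD addrA; apply: tensor_rel_r.
by rewrite opprD addrA; apply: tensor_rel_l.
Qed.

Lemma tensor_linear_ext (W : lmodType K) (f g : tensor U V -> W) :
  linear f -> linear g -> (forall u v, f (u ⊗ v) = g (u ⊗ v)) -> f = g.
Proof.
move=> lf lg fg; apply: funext => t; rewrite -[t]tensor_reprK.
pose F := HB.pack_for {linear _ -> _} f (GRing.isLinear.Build _ _ _ _ f lf).
pose G := HB.pack_for {linear _ -> _} g (GRing.isLinear.Build _ _ _ _ g lg).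
rewrite -[f]/(F : _ -> _) -[g]/(G : _ -> _).
rewrite [tensor_repr t]monalgE !linear_sum; apply: eq_bigr => -[u v] _.
have -> (x : K) : << x *g (u, v) >> = x *: << (u, v) >> :> {malg K[(U * V)%type]}.
  by apply/malgP=> k; rewrite mcoeffZ !mcoeffU mulrnAr mulr1.
by rewrite !linearZ /=; congr (_ *: _); have := fg u v; rewrite tens.unlock.
Qed.

Lemma tensor_universal (W : lmodType K) (f : U -> V -> W) :
  is_bilinear f ->
  exists! g : tensor U V -> W, linear g /\ forall u v, g (u ⊗ v) = f u v.
Proof.
move=> [fr fl].
pose F (x : {malg K[(U * V)%type]}) := \sum_(k <- msupp x) x@_k *: f k.1 k.2.
have Fw (d : {fset (U * V)%type}) x : (msupp x `<=` d)%fset ->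
    F x = \sum_(k <- d) x@_k *: f k.1 k.2.
  move=> le; rewrite /F (big_fset_incl _ le) // => k _ /mcoeff_outdom ->.
  by rewrite scale0r.
have Flin : linear F.
  move=> c x y; pose d := (msupp (c *: x + y) `|` msupp x `|` msupp y)%fset.
  rewrite !(Fw d) ?fsubsetUr //; first last.
  - by rewrite /d -fsetUA ?fsubsetUl // fsetUCA fsubsetUl.
  - by rewrite /d -fsetUA ?fsubsetUl // fsetUCA fsubsetUl.
  rewrite scaler_sumr -big_split /=; apply: eq_bigr => k _.
  by rewrite mcoeffD mcoeffZ scalerDl scalerA.
pose L := HB.pack_for {linear _ -> _} F (GRing.isLinear.Build _ _ _ _ F Flin).
have FU u v : F << (u, v) >> = f u v.
  by rewrite /F msuppU oner_eq0 big_seq_fset1 mcoeffUU scale1r.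
have F0 x : tensor_rel x -> F x = 0.
  elim=> [c u u' v|c u v v'||c x' y' _ Hx _ Hy]; rewrite -[F]/(L : _ -> _).
  - by rewrite !linearB linearZ /= !FU fl [_ + f u' v]addrC addrK subrr.
  - by rewrite !linearB linearZ /= !FU fr [_ + f u v']addrC addrK subrr.
  - exact: linear0.
  - by rewrite linearP /= Hx Hy scaler0 addr0.
have Fpi x : F (tensor_repr (tensor_pi x)) = F x.
  apply/eqP; rewrite -subr_eq0 -[F]/(L : _ -> _) -linearB; apply/eqP/F0.
  by apply/tensor_piP; rewrite tensor_reprK.
have glin : linear (fun t : tensor U V => F (tensor_repr t)).
  move=> c t t'; rewrite -{1}[t]tensor_reprK -{1}[t']tensor_reprK -linearP.
  by rewrite Fpi Flin.
exists (fun t => F (tensor_repr t)); split=> [|g [lg gE]].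
  by split=> // u v; rewrite tens.unlock Fpi FU.
by apply: tensor_linear_ext => // u v; rewrite tens.unlock Fpi FU -gE tens.unlock.
Qed.

End TensorUniversal.

Section HomNS.
Context (K : fieldType) (G : lmodType K).

Record ns_data := NSData {
  ns_prec : G -> G -> G;
  ns_succ : G -> G -> G;
  ns_vee : G -> G -> G;
  ns_map : G -> G }.

Definition ns_multilinear (A : ns_data) : Prop :=
  [/\ is_bilinear (ns_prec A), is_bilinear (ns_succ A),
      is_bilinear (ns_vee A) & linear (ns_map A)].

Record is_hom_ns (A : ns_data) : Prop := IsHomNS {
  _ : ns_multilinear A;
  _ : {morph ns_map A : x y / ns_prec A x y};
  _ : {morph ns_map A : x y / ns_succ A x y};
  _ : {morph ns_map A : x y / ns_vee A x y};
  _ : let prec := ns_prec A in let succ := ns_succ A in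
      let vee := ns_vee A in let p := ns_map A in
      let ast x y := prec x y + succ x y + vee x y in
      forall x y z,
      [/\ prec (prec x y) (p z) = prec (p x) (ast y z),
          prec (succ x y) (p z) = succ (p x) (prec y z),
          succ (ast x y) (p z) = succ (p x) (succ y z) &
          vee (ast x y) (p z) + prec (vee x y) (p z)
          = succ (p x) (vee y z) + vee (p x) (ast y z)] }.

End HomNS.

Record is_hom_ns_morphism (K : fieldType) (G G' : lmodType K)
    (A : ns_data G) (A' : ns_data G') (f : G -> G') : Prop := IsHomNSMorphism {
  _ : linear f;
  _ : forall x y, f (ns_prec A x y) = ns_prec A' (f x) (f y);
  _ : forall x y, f (ns_succ A x y) = ns_succ A' (f x) (f y);
  _ : forall x y, f (ns_vee A x y) = ns_vee A' (f x) (f y);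
  _ : forall x, f (ns_map A x) = ns_map A' (f x) }.

Section HomNSFamily.
Context (K : fieldType) (Omega : semigroupType) (G : lmodType K).

Record ns_family_data := NSFamilyData {
  nsf_prec : Omega -> G -> G -> G;
  nsf_succ : Omega -> G -> G -> G;
  nsf_vee : Omega -> Omega -> G -> G -> G;
  nsf_map : G -> G }.

Record is_hom_ns_family (A : ns_family_data) : Prop := IsHomNSFamily {
  _ : forall a, is_bilinear (nsf_prec A a);
  _ : forall a, is_bilinear (nsf_succ A a);
  _ : forall a b, is_bilinear (nsf_vee A a b);
  _ : linear (nsf_map A);
  _ : forall a, {morph nsf_map A : x y / nsf_prec A a x y};
  _ : forall a, {morph nsf_map A : x y / nsf_succ A a x y};
  _ : forall a b, {morph nsf_map A : x y / nsf_vee A a b x y};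
  _ : let prec := nsf_prec A in let succ := nsf_succ A in
      let vee := nsf_vee A in let p := nsf_map A in
      let ast a b x y := prec b x y + succ a x y + vee a b x y in
      forall x y z a b c,
      [/\ prec (a * b)%g (p x) (ast a b y z) = prec b (prec a x y) (p z),
          prec b (succ a x y) (p z) = succ a (p x) (prec b y z),
          succ (a * b)%g (ast a b x y) (p z) = succ a (p x) (succ b y z) &
          succ a (p x) (vee b c y z) + vee a (b * c)%g (p x) (ast b c y z)
          = prec c (vee a b x y) (p z) + vee (a * b)%g c (ast a b x y) (p z)] }.

End HomNSFamily.

Record is_hom_ns_family_morphism (K : fieldType) (Omega : semigroupType)
    (G G' : lmodType K) (A : ns_family_data Omega G)
    (A' : ns_family_data Omega G') (f : G -> G') : Prop :=
  IsHomNSFamilyMorphism {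
  _ : linear f;
  _ : forall a x y, f (nsf_prec A a x y) = nsf_prec A' a (f x) (f y);
  _ : forall a x y, f (nsf_succ A a x y) = nsf_succ A' a (f x) (f y);
  _ : forall a b x y, f (nsf_vee A a b x y) = nsf_vee A' a b (f x) (f y);
  _ : forall x, f (nsf_map A x) = nsf_map A' (f x) }.

(* G (x) K Omega. Only the vector space underlying the semigroup algebra is
   needed: the product of the basis vectors at a and b is the one at a * b. *)
Definition tensor_sg (K : fieldType) (Omega : semigroupType) (G : lmodType K) :
  lmodType K := tensor G {malg K[Omega]}.

Definition tens_sg (K : fieldType) (Omega : semigroupType) (G : lmodType K)
  (x : G) (a : Omega) : tensor_sg Omega G := x ⊗ << a%g >>.

(* The formulas on the generators x (x) a, extended (bi)linearly. *)
Record is_induced_ns (K : fieldType) (Omega : semigroupType) (G : lmodType K)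
    (A : ns_family_data Omega G) (B : ns_data (tensor_sg Omega G)) : Prop :=
  IsInducedNS {
  _ : ns_multilinear B;
  _ : forall x y a b, ns_prec B (tens_sg x a) (tens_sg y b)
        = tens_sg (nsf_prec A b x y) (a * b)%g;
  _ : forall x y a b, ns_succ B (tens_sg x a) (tens_sg y b)
        = tens_sg (nsf_succ A a x y) (a * b)%g;
  _ : forall x y a b, ns_vee B (tens_sg x a) (tens_sg y b)
        = tens_sg (nsf_vee A a b x y) (a * b)%g;
  _ : forall x a, ns_map B (tens_sg x a) = tens_sg (nsf_map A x) a }.

Definition is_induced_map (K : fieldType) (Omega : semigroupType)
    (G G' : lmodType K) (f : G -> G')
    (g : tensor_sg Omega G -> tensor_sg Omega G') : Prop :=
  linear g /\ forall x a, g (tens_sg x a) = tens_sg (f x) a.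

(* Main.v *)
(* The elements x (x) a span G (x) K Omega, so (multi)linear maps are determined
   by their values on them, and any family of (bi)linear maps indexed by Omega
   extends. Every identity is thus checked on generators, where the two sides
   have the same Omega-component by associativity and the G-components agree by
   the axioms of A. *)
From HB Require Import structures.
Require Import Defs.
From mathcomp Require Import all_boot all_order all_algebra.
From mathcomp Require Import finmap boolp monalg.

Set Implicit Arguments.
Unset Strict Implicit.
Unset Printing Implicit Defensive.

Import GRing.Theory.
Local Open Scope ring_scope.

(** * Closure properties of linear and bilinear maps, and linear extension from a basis *)

Section LinearMaps.
Context (K : fieldType).
Implicit Types U V W X : lmodType K.

Lemma linear_add U V (f g : U -> V) :
  linear f -> linear g -> linear (fun u => f u + g u).
Proof. by move=> lf lg c x y; rewrite lf lg scalerDr addrACA. Qed.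

Lemma linear_comp U V W (f : V -> W) (g : U -> V) :
  linear f -> linear g -> linear (fun u => f (g u)).
Proof. by move=> lf lg c x y; rewrite lg lf. Qed.

(** Scaling by [c] commutes with the scalars because K is commutative. This makes the right-hand
    side of a linearity law a linear map in a second variable, so that the law itself can be checked
    on generators of that variable. *)
Lemma linear_combination U V (f g : U -> V) (c : K) :
  linear f -> linear g -> linear (fun u => c *: f u + g u).
Proof.
move=> lf lg; apply: linear_add => // d x y.
by rewrite lf scalerDr !scalerA mulrC.
Qed.

Lemma bilinearl U V W (f : U -> V -> W) v :
  is_bilinear f -> linear (fun u => f u v).
Proof. by case. Qed.

Lemma bilinearr U V W (f : U -> V -> W) u : is_bilinear f -> linear (f u).
Proof. by case. Qed.

Lemma bilinear_comp U V W X (f : U -> V -> W) (h : W -> X) :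
  linear h -> is_bilinear f -> is_bilinear (fun u v => h (f u v)).
Proof. by move=> lh [fr fl]; split=> u; apply: linear_comp. Qed.

Lemma bilinear_compl U V W X (f : U -> V -> W) (h : X -> U) :
  linear h -> is_bilinear f -> is_bilinear (fun x v => f (h x) v).
Proof.
move=> lh [fr fl]; split=> [x|v]; first exact: fr.
exact: (linear_comp (fl v) lh).
Qed.

Lemma bilinear_compr U V W X (f : U -> V -> W) (h : X -> V) :
  linear h -> is_bilinear f -> is_bilinear (fun u x => f u (h x)).
Proof.
move=> lh [fr fl]; split=> [u|x]; last exact: fl.
exact: (linear_comp (fr u) lh).
Qed.

(** Each [m] is the finite sum of its coefficients times basis vectors. *)
Lemma malg_linear_ext (X : choiceType) W (f g : {malg K[X]} -> W) :
  linear f -> linear g -> (forall a, f << a >> = g << a >>) -> f = g.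
Proof.
move=> lf lg fg; apply: funext => m.
pose F := HB.pack_for {linear _ -> _} f (GRing.isLinear.Build _ _ _ _ f lf).
pose G := HB.pack_for {linear _ -> _} g (GRing.isLinear.Build _ _ _ _ g lg).
rewrite -[f]/(F : _ -> _) -[g]/(G : _ -> _).
rewrite [m]monalgE !linear_sum; apply: eq_bigr => a _.
have -> : << m@_a *g a >> = m@_a *: << a >> :> {malg K[X]}.
  by apply/malgP=> k; rewrite mcoeffZ !mcoeffU mulrnAr mulr1.
by rewrite !linearZ /=; congr (_ *: _); apply: fg.
Qed.

Definition malg_lift (X : choiceType) W (phi : X -> W) (m : {malg K[X]}) : W :=
  \sum_(a <- msupp m) m@_a *: phi a.

Lemma malg_liftU (X : choiceType) W (phi : X -> W) a :
  malg_lift phi << a >> = phi a.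
Proof. by rewrite /malg_lift msuppU oner_eq0 big_seq_fset1 mcoeffUU scale1r. Qed.

Lemma malg_lift_linear (X : choiceType) W (phi : X -> W) :
  linear (malg_lift phi).
Proof.
(* The three supports may differ, so all sums are taken over the common finite set [d]; the added
   terms have coefficient 0. *)
move=> c x y; pose d := (msupp (c *: x + y) `|` (msupp x `|` msupp y))%fset.
have liftE m : (msupp m `<=` d)%fset ->
    malg_lift phi m = \sum_(a <- d) m@_a *: phi a.
  move=> le; rewrite /malg_lift (big_fset_incl _ le) // => k _.
  by move=> /mcoeff_outdom ->; rewrite scale0r.
rewrite !liftE ?fsubsetUl //; first last.
- by rewrite /d fsetUCA fsubsetUl.
- by rewrite /d fsetUA fsubsetUr.
rewrite scaler_sumr -big_split /=; apply: eq_bigr => k _.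
by rewrite mcoeffD mcoeffZ scalerDl scalerA.
Qed.

(** For fixed [m] the sum runs over the support of [m], which does not depend on [u], so linearity
    in [u] holds term by term. *)
Lemma malg_lift_bilinear (X : choiceType) U W (phi : U -> X -> W) :
  (forall a, linear (fun u => phi u a)) ->
  is_bilinear (fun u => malg_lift (phi u)).
Proof.
move=> lphi; split=> [u|m c u u']; first exact: malg_lift_linear.
rewrite /malg_lift scaler_sumr -big_split /=; apply: eq_bigr => k _.
by rewrite lphi scalerDr !scalerA mulrC.
Qed.

End LinearMaps.

(** * Uniqueness and existence of (multi)linear maps with prescribed values on the generators
    [tens_sg x a] *)

Section TensorSemigroup.
Context (K : fieldType) (Omega : semigroupType).
Implicit Types G H W : lmodType K.

Lemma tens_sg_linear G (a : Omega) : linear (fun x : G => tens_sg x a).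
Proof. exact: (bilinearl _ (tens_bilinear _ _)). Qed.

Lemma tens_sgD G (x y : G) (a : Omega) :
  tens_sg (x + y) a = tens_sg x a + tens_sg y a.
Proof. by have := tens_sg_linear a 1 x y; rewrite !scale1r. Qed.

(** Pure tensors suffice by [tensor_linear_ext]; for a fixed left factor, both maps are linear in
    the right factor, so its basis vectors suffice. *)
Lemma tensor_sg_ext G W (f g : tensor_sg Omega G -> W) :
  linear f -> linear g ->
  (forall x a, f (tens_sg x a) = g (tens_sg x a)) -> forall t, f t = g t.
Proof.
move=> lf lg fg t; congr (_ t); apply: tensor_linear_ext => // x m.
have lx := bilinearr x (tens_bilinear G {malg K[Omega]}).
exact: (congr1 (fun h => h m) (malg_linear_ext (linear_comp lf lx)
  (linear_comp lg lx) (fg x))).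
Qed.

Lemma tensor_sg_ext2 G H W (f g : tensor_sg Omega G -> tensor_sg Omega H -> W) :
  is_bilinear f -> is_bilinear g ->
  (forall x a y b, f (tens_sg x a) (tens_sg y b)
                 = g (tens_sg x a) (tens_sg y b)) -> forall s t, f s t = g s t.
Proof.
move=> [fr fl] [gr gl] fg s t; move: s.
apply: (tensor_sg_ext (fl t) (gl t)) => x a; move: t.
by apply: tensor_sg_ext.
Qed.

(** Extending [phi x] linearly from Omega gives a bilinear map, which factors through the tensor
    product. *)
Lemma tensor_sg_lift G W (phi : G -> Omega -> W) :
  (forall a, linear (fun x => phi x a)) ->
  exists g : tensor_sg Omega G -> W,
    linear g /\ forall x a, g (tens_sg x a) = phi x a.
Proof.
move=> /malg_lift_bilinear/tensor_universal[g [[lg gE] _]].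
by exists g; split=> // x a; rewrite gE malg_liftU.
Qed.

Lemma tensor_sg_lift2 G H W (phi : Omega -> Omega -> G -> H -> W) :
  (forall a b, is_bilinear (phi a b)) ->
  exists g : tensor_sg Omega G -> tensor_sg Omega H -> W, is_bilinear g /\
    forall x y a b, g (tens_sg x a) (tens_sg y b) = phi a b x y.
Proof.
(* Lift in the first variable for each fixed (y, b). The result is linear in y
   for each fixed s, so it lifts in the second variable. *)
move=> bphi.
have /choice[L LP] (yb : H * Omega) : exists g : tensor_sg Omega G -> W,
    linear g /\ forall x a, g (tens_sg x a) = phi a yb.2 x yb.1.
  by apply: tensor_sg_lift => a; apply: bilinearl.
have /choice[M MP] (s : tensor_sg Omega G) : exists g : tensor_sg Omega H -> W,
    linear g /\ forall y b, g (tens_sg y b) = L (y, b) s.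
  (* Linearity in [y] is an equality of two linear maps in [s]; on generators it becomes linearity
     of [phi a b x]. *)
  apply: tensor_sg_lift => b c y y'; move: s; apply: tensor_sg_ext.
  - exact: (LP _).1.
  - by apply: linear_combination; apply: (LP _).1.
  move=> x a; rewrite !(LP _).2 /=; exact: (bphi a b).1.
exists M; split=> [|x y a b]; last by rewrite (MP _).2 (LP _).2.
split=> [s|t c s s']; first exact: (MP s).1.
(* Likewise linearity in [s] is checked on generators of [t], where [M] reduces to [L (y, b)],
   linear by construction. *)
move: t; apply: tensor_sg_ext.
- exact: (MP _).1.
- by apply: linear_combination; apply: (MP _).1.
by move=> y b; rewrite !(MP _).2 (LP _).1.
Qed.

(** Serves the Hom-NS axioms, whose two sides are trilinear. Trilinearity is split as bilinear in
    the first two variables plus linear in the third, to match the two extensionality lemmas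
    above. *)
Lemma tensor_sg_ext3 G H (I W : lmodType K)
    (f g : tensor_sg Omega G -> tensor_sg Omega H -> tensor_sg Omega I -> W) :
  (forall s t, linear (f s t)) -> (forall u, is_bilinear (fun s t => f s t u)) ->
  (forall s t, linear (g s t)) -> (forall u, is_bilinear (fun s t => g s t u)) ->
  (forall x a y b z c, f (tens_sg x a) (tens_sg y b) (tens_sg z c)
                     = g (tens_sg x a) (tens_sg y b) (tens_sg z c)) ->
  forall s t u, f s t u = g s t u.
Proof.
move=> f3 f12 g3 g12 fg s t u; move: s t.
apply: (tensor_sg_ext2 (f12 u) (g12 u)) => x a y b; move: u.
by apply: tensor_sg_ext.
Qed.

End TensorSemigroup.

(** * The induced Hom-NS-algebra: existence, uniqueness and axioms *)

Section InducedAlgebra.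
Context (K : fieldType) (Omega : semigroupType) (G : lmodType K).
Variable A : ns_family_data Omega G.
Hypothesis hA : is_hom_ns_family A.
Local Notation T := (tensor_sg Omega G).

Lemma induced_ns_exists : exists B, is_induced_ns A B.
Proof.
case: hA => lprec lsucc lvee lp _ _ _ _.
have lift (phi : Omega -> Omega -> G -> G -> G) :
    (forall a b, is_bilinear (phi a b)) ->
    exists g : T -> T -> T,
      is_bilinear g /\ forall x y a b,
      g (tens_sg x a) (tens_sg y b) = tens_sg (phi a b x y) (a * b)%g.
  move=> bphi.
  apply: (tensor_sg_lift2
    (phi := fun a b x y => tens_sg (phi a b x y) (a * b)%g)).
  by move=> a b; exact: (bilinear_comp (@tens_sg_linear _ _ _ (a * b)%g)).
(* The operation for [prec] is indexed by the right factor, that for [succ] by the left factor, and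
   that for [vee] by both. *)
have [prec [bprec precE]] := lift _ (fun _ b => lprec b).
have [succ [bsucc succE]] := lift _ (fun a _ => lsucc a).
have [vee [bvee veeE]] := lift _ lvee.
have [p [blp pE]] : exists g : T -> T,
    linear g /\ forall x a, g (tens_sg x a) = tens_sg (nsf_map A x) a.
  apply: (tensor_sg_lift (phi := fun x a => tens_sg (nsf_map A x) a)) => a.
  exact: (linear_comp (@tens_sg_linear _ _ _ a) lp).
by exists (NSData prec succ vee p).
Qed.

Lemma induced_ns_unique B B' : is_induced_ns A B -> is_induced_ns A B' -> B = B'.
Proof.
case: B B' => [prec succ vee p] [prec' succ' vee' p'].
move=> [[/= b1 b2 b3 b4] /= e1 e2 e3 e4] [[/= b1' b2' b3' b4'] /= e1' e2' e3' e4'].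
congr NSData.
- apply: funext => s; apply: funext => t; move: s t.
  by apply: tensor_sg_ext2 => // *; rewrite e1 e1'.
- apply: funext => s; apply: funext => t; move: s t.
  by apply: tensor_sg_ext2 => // *; rewrite e2 e2'.
- apply: funext => s; apply: funext => t; move: s t.
  by apply: tensor_sg_ext2 => // *; rewrite e3 e3'.
by apply: funext; apply: tensor_sg_ext => // *; rewrite e4 e4'.
Qed.

Lemma induced_ns_hom B : is_induced_ns A B -> is_hom_ns B.
Proof.
case: B => [prec succ vee p].
move=> [[/= bprec bsucc bvee lp] /= precE succE veeE pE].
case: hA => _ _ _ _ pprec psucc pvee ax; cbv zeta in ax.
have bpp (f : T -> T -> T) : is_bilinear f ->
    is_bilinear (fun s t => f (p s) (p t)).
  by move=> bf; exact: (bilinear_compl lp (bilinear_compr lp bf)).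
have bast : is_bilinear (fun s t => prec s t + succ s t + vee s t).
  case: bprec bsucc bvee => [? ?] [? ?] [? ?].
  by split=> ?; do 2?apply: linear_add.
(* Every term of the Hom-NS axioms has the shape [f (g s t) (p u)] or [f (p s) (g t u)]; these four
   facts supply the linearity hypotheses of [tensor_sg_ext3] for both shapes. *)
have lin3l (f g : T -> T -> T) s t : is_bilinear f ->
    linear (fun u => f (g s t) (p u)).
  by move=> bf; exact: (linear_comp (bilinearr _ bf) lp).
have lin12l (f g : T -> T -> T) u : is_bilinear f -> is_bilinear g ->
    is_bilinear (fun s t => f (g s t) (p u)).
  by move=> bf bg; exact: (bilinear_comp (bilinearl (p u) bf) bg).
have lin3r (f g : T -> T -> T) s t : is_bilinear f -> is_bilinear g ->
    linear (fun u => f (p s) (g t u)).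
  by move=> bf bg; exact: (linear_comp (bilinearr _ bf) (bilinearr _ bg)).
have lin12r (f g : T -> T -> T) u : is_bilinear f -> is_bilinear g ->
    is_bilinear (fun s t => f (p s) (g t u)).
  move=> bf bg.
  exact: (bilinear_compl lp (bilinear_compr (bilinearl u bg) bf)).
split=> //=.
- apply: tensor_sg_ext2; [exact: (bilinear_comp lp) | exact: bpp |].
  by move=> *; rewrite !(pE, precE) pprec.
- apply: tensor_sg_ext2; [exact: (bilinear_comp lp) | exact: bpp |].
  by move=> *; rewrite !(pE, succE) psucc.
- apply: tensor_sg_ext2; [exact: (bilinear_comp lp) | exact: bpp |].
  by move=> *; rewrite !(pE, veeE) pvee.
have bilinear_add (f g : T -> T -> T) : is_bilinear f -> is_bilinear g ->
    is_bilinear (fun s t => f s t + g s t).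
  by case=> [? ?] [? ?]; split=> ?; apply: linear_add.
pose ast s t := prec s t + succ s t + vee s t.
move=> s t u; split; move: s t u.
- apply: tensor_sg_ext3 => [s t|u|s t|u|x a y b z c].
  + exact: (lin3l prec prec).
  + exact: (lin12l prec prec).
  + exact: (lin3r prec ast).
  + exact: (lin12r prec ast).
  (* The three summands of [ast] on generators share one Omega-component, so they merge into a
     single generator, on which the outer operation can be evaluated. *)
  rewrite !(pE, precE, succE, veeE) -!tens_sgD !(precE, succE) -mulgA.
  (* Only the indices of the two right-hand factors survive, so the first family axiom is taken at
     [b] and [c]; the last [c] merely fills the third index. *)
  by have /= [-> _ _ _] := ax x y z b c c.
- apply: tensor_sg_ext3 => [s t|u|s t|u|x a y b z c].
  + exact: (lin3l prec succ).
  + exact: (lin12l prec succ).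
  + exact: (lin3r succ prec).
  + exact: (lin12r succ prec).
  rewrite !(pE, precE, succE) -mulgA.
  (* Here the outer indices [a] and [c] survive, and the middle index [b] enters only through the
     Omega-component. *)
  by have /= [_ -> _ _] := ax x y z a c c.
- apply: tensor_sg_ext3 => [s t|u|s t|u|x a y b z c].
  + exact: (lin3l succ ast).
  + exact: (lin12l succ ast).
  + exact: (lin3r succ succ).
  + exact: (lin12r succ succ).
  rewrite !(pE, precE, succE, veeE) -!tens_sgD !(precE, succE) -mulgA.
  by have /= [_ _ -> _] := ax x y z a b c.
apply: tensor_sg_ext3 => [s t|u|s t|u|x a y b z c].
- exact: (linear_add (lin3l vee ast _ _ _) (lin3l prec vee _ _ _)).
- exact: (bilinear_add _ _ (lin12l vee ast _ _ _) (lin12l prec vee _ _ _)).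
- exact: (linear_add (lin3r succ vee _ _ _ _) (lin3r vee ast _ _ _ _)).
- exact: (bilinear_add _ _ (lin12r succ vee _ _ _) (lin12r vee ast _ _ _)).
rewrite !(pE, precE, succE, veeE) -!tens_sgD !(precE, succE, veeE) -!mulgA.
(* After reassociation all four terms have the same Omega-component, so each side becomes one
   generator. *)
rewrite -!tens_sgD.
(* The family axiom lists its [prec] and [vee] terms in the opposite order, hence [addrC]. *)
by have /= [_ _ _ ->] := ax x y z a b c; rewrite addrC.
Qed.

End InducedAlgebra.

(** * The linear map induced by a morphism of Hom-NS-family algebras *)

Section InducedMorphism.
Context (K : fieldType) (Omega : semigroupType) (G G' : lmodType K).

Lemma induced_map_exists (f : G -> G') : linear f ->
  exists fbar : tensor_sg Omega G -> tensor_sg Omega G', is_induced_map f fbar.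
Proof.
move=> lf; apply: (tensor_sg_lift (phi := fun x a => tens_sg (f x) a)) => a.
exact: (linear_comp (@tens_sg_linear _ _ _ a) lf).
Qed.

Lemma induced_map_unique (f : G -> G')
    (g h : tensor_sg Omega G -> tensor_sg Omega G') :
  is_induced_map f g -> is_induced_map f h -> g = h.
Proof.
move=> [lg gE] [lh hE]; apply: funext.
by apply: tensor_sg_ext => // x a; rewrite gE hE.
Qed.

Lemma induced_map_hom (A : ns_family_data Omega G) (A' : ns_family_data Omega G')
    f fbar B B' :
  is_hom_ns_family_morphism A A' f -> is_induced_map f fbar ->
  is_induced_ns A B -> is_induced_ns A' B' -> is_hom_ns_morphism B B' fbar.
Proof.
move=> [_ fprec fsucc fvee fp] [lg gE].
move=> [[b1 b2 b3 lp] e1 e2 e3 e4] [[b1' b2' b3' lp'] e1' e2' e3' e4'].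
(* This makes the right-hand side of each preservation law bilinear; on generators the law reduces
   to that of [f], since [fbar] fixes the Omega-component. *)
have bgg h : is_bilinear h -> is_bilinear (fun s t => h (fbar s) (fbar t)).
  by move=> bh; exact: (bilinear_compl lg (bilinear_compr lg bh)).
split=> //.
- apply: tensor_sg_ext2; [exact: (bilinear_comp lg) | exact: bgg |].
  by move=> *; rewrite e1 !gE e1' fprec.
- apply: tensor_sg_ext2; [exact: (bilinear_comp lg) | exact: bgg |].
  by move=> *; rewrite e2 !gE e2' fsucc.
- apply: tensor_sg_ext2; [exact: (bilinear_comp lg) | exact: bgg |].
  by move=> *; rewrite e3 !gE e3' fvee.
apply: tensor_sg_ext;
  [exact: (linear_comp lg lp) | exact: (linear_comp lp' lg) |].
by move=> *; rewrite e4 !gE e4' fp.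
Qed.

End InducedMorphism.

Theorem proposition3p6 (K : fieldType) (char0 : [pchar K]%R =i pred0)
    (Omega : semigroupType) (G : lmodType K) (A : ns_family_data Omega G)
    (hA : is_hom_ns_family A) :
  (exists2 B : ns_data (tensor_sg Omega G),
     unique (is_induced_ns A) B & is_hom_ns B) /\
  (forall (G' : lmodType K) (A' : ns_family_data Omega G')
     (hA' : is_hom_ns_family A') (f : G -> G'),
   is_hom_ns_family_morphism A A' f ->
   forall (B : ns_data (tensor_sg Omega G)) (B' : ns_data (tensor_sg Omega G')),
   is_induced_ns A B -> is_induced_ns A' B' ->
   exists2 fbar : tensor_sg Omega G -> tensor_sg Omega G',
     unique (is_induced_map f) fbar & is_hom_ns_morphism B B' fbar).
Proof.
split.
  have [B hB] := induced_ns_exists hA.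
  exists B; last exact: induced_ns_hom hA _ hB.
  by split=> // B'; apply: induced_ns_unique.
move=> G' A' hA' f hf B B' hB hB'.
have [g hg] : exists g : tensor_sg Omega G -> tensor_sg Omega G',
    is_induced_map f g by case: hf => lf _ _ _ _; apply: induced_map_exists.
exists g; last exact: induced_map_hom hf hg hB hB'.
by split=> // h; apply: induced_map_unique.
Qed.
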